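(* Let $K$ be a field, $H_K$ a finite-dimensional $K$-vector space, and $H^\lambda_K=H_K\otimes_K K[\lambda]$. Let $\ast$ be an associative commutative $K[\lambda]$-algebra structure with unit on $H^\lambda_K$, and let $g^\lambda$ be a localized $K[\lambda]$-metric on $H^\lambda_K$ which is $\ast$-invariant, i.e. $$g^\lambda(\boldsymbol{x}\ast\boldsymbol{y},\boldsymbol{z})=g^\lambda(\boldsymbol{x},\boldsymbol{y}\ast\boldsymbol{z})\qquad(\boldsymbol{x},\boldsymbol{y},\boldsymbol{z}\in H^\lambda_K).$$ Equip $H_K=H^\lambda_K/\lambda H^\lambda_K$ with the multiplication induced by $\ast$ and with the nondegenerate filtration $(I_\bullet,g_\bullet)$ induced from $g^\lambda$. Then $(H_K,I_\bullet,g_\bullet)$ is a mixed Frobenius algebra.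
   Context: A localized $K[\lambda]$-metric on $H^\lambda_K$ is a symmetric $K[\lambda]$-bilinear form $g^\lambda:H^\lambda_K\times H^\lambda_K\to K[\lambda,\lambda^{-1}]$ which is unimodular over $K[\lambda,\lambda^{-1}]$, i.e. its Gram matrix in a $K[\lambda]$-basis of $H^\lambda_K$ is invertible over $K[\lambda,\lambda^{-1}]$. Let $\pi:H^\lambda_K\to H_K=H^\lambda_K/\lambda H^\lambda_K$ be the projection. For $k\in\mathbb{Z}$ set $$I_k^\lambda=\{\boldsymbol{x}\in H^\lambda_K\mid \lambda^k g^\lambda(\boldsymbol{x},\boldsymbol{y})\in K[\lambda]\ \text{for all } \boldsymbol{y}\in H^\lambda_K\},\qquad I_k=\pi(I_k^\lambda).$$ The bilinear form $g_k$ on $I_k/I_{k-1}$ is $g_k(\bar x,\bar y)=\mathrm{Res}_{\lambda=0}\,\lambda^{k-1}g^\lambda(\boldsymbol{x},\boldsymbol{y})$ for $x,y\in I_k$, where $\bar x$ is the class modulo $I_{k-1}$ and $\boldsymbol{x},\boldsymbol{y}\in I_k^\lambda$ are any lifts of $x,y$ (independent of choices). This is the nondegenerate filtration induced from $g^\lambda$. A metric is a nondegenerate symmetric bilinear form. A nondegenerate filtration on a finite-dimensional $K$-vector space $V$ is a pair $(I_\bullet,g_\bullet)$ consisting of an exhaustive increasing filtration of $V$ by subspaces ($I_{k-1}\subset I_k$ for all $k\in\mathbb{Z}$, $I_k=V$ for $k\gg0$, $I_k=0$ for $k\ll0$) and a metric $g_k$ on each $I_k/I_{k-1}$. A Frobenius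 filtration on a finite-dimensional commutative associative unital $K$-algebra $A$ is a nondegenerate filtration $(I_\bullet,g_\bullet)$ on $A$ such that each $I_k$ is an ideal of $A$ and each $g_k$ is $A/I_{k-1}$-invariant, i.e. $g_k(a\cdot x,y)=g_k(x,a\cdot y)$ for $a\in A/I_{k-1}$, $x,y\in I_k/I_{k-1}$. A mixed Frobenius algebra is such an algebra $A$ together with a Frobenius filtration on it. *)

(* Defs.v *)
From HB Require Import structures.
From mathcomp Require Import all_boot all_order all_algebra.
From mathcomp Require Import zify.

Set Implicit Arguments.
Unset Strict Implicit.
Unset Printing Implicit Defensive.

Import GRing.Theory passmx.
Local Open Scope ring_scope.
Local Open Scope quotient_scope.

(* The quotient U / (U :&: W), which is U / W when W <= U.                    *)
Section SubQuotient.
Variables (K : fieldType) (V : vectType K) (U W : {vspace V}).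

Definition subv_pred : {pred subvs_of U} := fun u => vsval u \in W.

Fact subv_pred_zmod_closed : zmod_closed subv_pred.
Proof.
split=> [|u v]; first by rewrite unfold_in /subv_pred raddf0 mem0v.
move=> uW vW; change (vsval (u - v) \in W).
by rewrite raddfB; apply: rpredB.
Qed.
HB.instance Definition _ :=
  GRing.isZmodClosed.Build (subvs_of U) subv_pred subv_pred_zmod_closed.

Definition subquot : Type := Quotient.quot subv_pred.
HB.instance Definition _ := GRing.Zmodule.on subquot.
HB.instance Definition _ := EqQuotient.on subquot.

(* The class of v modulo W, for v in U (vsproj U is a section of vsval).      *)
Definition cls (v : V) : subquot := \pi_subquot (vsproj U v).

Definition subquot_scale (a : K) : subquot -> subquot :=
  fun x => \pi_subquot (a *: (repr x : subvs_of U)).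

Lemma subquot_eqP (u v : subvs_of U) :
  reflect (\pi_subquot u = \pi_subquot v) (vsval u - vsval v \in W).
Proof.
have -> : (vsval u - vsval v \in W) = (u == v %[mod subquot]).
  by rewrite -(Quotient.idealrBE subv_pred) [RHS]unfold_in /subv_pred.
exact: eqP.
Qed.

Lemma subquot_scale_pi a u :
  subquot_scale a (\pi_subquot u) = \pi_subquot (a *: u).
Proof.
apply/subquot_eqP; rewrite /= -scalerBr memvZ //.
by apply/subquot_eqP; rewrite reprK.
Qed.

Lemma subquot_piD u v :
  \pi_subquot (u + v) = \pi_subquot u + \pi_subquot v :> subquot.
Proof. exact: (Quotient.pi_add subv_pred). Qed.

Fact subquot_scaleA a b x :
  subquot_scale a (subquot_scale b x) = subquot_scale (a * b) x.
Proof. by elim/quotW: x => u; rewrite !(subquot_scale_pi _ u) !subquot_scale_pi scalerA. Qed.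
Fact subquot_scale1 : left_id 1 subquot_scale.
Proof. by elim/quotW=> u; rewrite subquot_scale_pi scale1r. Qed.
Fact subquot_scaleDr : right_distributive subquot_scale +%R.
Proof.
move=> a; elim/quotW=> u; elim/quotW=> v.
by rewrite -subquot_piD (subquot_scale_pi _ u) (subquot_scale_pi _ v) subquot_scale_pi
  scalerDr subquot_piD.
Qed.
Fact subquot_scaleDl x : {morph subquot_scale^~ x : a b / a + b}.
Proof.
by elim/quotW: x => u a b; rewrite !(subquot_scale_pi _ u) scalerDl subquot_piD.
Qed.
HB.instance Definition _ := GRing.Zmodule_isLmodule.Build K subquot
  subquot_scaleA subquot_scale1 subquot_scaleDr subquot_scaleDl.

Lemma cls_eqP u v : u \in U -> v \in U -> reflect (cls u = cls v) (u - v \in W).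
Proof.
move=> uU vU; have := subquot_eqP (vsproj U u) (vsproj U v).
by rewrite !vsprojK.
Qed.

Lemma cls_surj (x : subquot) : exists2 u, u \in U & x = cls u.
Proof.
exists (vsval (repr x)); first exact: subvsP.
by rewrite /cls vsvalK reprK.
Qed.

End SubQuotient.

Definition metric (K : fieldType) (V : lmodType K) (b : V -> V -> K) : Prop :=
  [/\ bilinear_for *%R *%R b,
      forall x y, b x y = b y x
    & forall x, (forall y, b x y = 0) -> x = 0].

Record nondegenerate_filtration (K : fieldType) (V : vectType K) := {
  filt : int -> {vspace V};
  form : forall k : int,
    subquot (filt k) (filt (k - 1)) -> subquot (filt k) (filt (k - 1)) -> K;
  filt_le : forall k, (filt (k - 1) <= filt k)%VS;
  filt_full : exists k0 : int, forall k, k0 <= k -> filt k = fullv;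
  filt_zero : exists k0 : int, forall k, k <= k0 -> filt k = 0%VS;
  form_metric : forall k, metric (@form k)
}.
Arguments form {K V} _ k _ _.

Definition gr (K : fieldType) (V : vectType K) (F : nondegenerate_filtration V)
    (k : int) (x : V) : subquot (filt F k) (filt F (k - 1)) := cls _ _ x.

(* Algebras are given by a multiplication on a fixed module because the zero  *)
(* algebra is allowed.                                                        *)
Definition comm_unital_algebra (R : comNzRingType) (A : lmodType R)
    (mul : A -> A -> A) : Prop :=
  [/\ bilinear_for *:%R *:%R mul, associative mul, commutative mul
    & exists one, left_id one mul].

(* By the first clause the class of a in A / I_(k-1) acts on I_k / I_(k-1) by *)
(* sending the class of x to the class of mul a x; invariance is stated on    *)
(* representatives a, x, y.                                                   *)
Definition frobenius_filtration (K : fieldType) (A : vectType K)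
    (mul : A -> A -> A) (F : nondegenerate_filtration A) : Prop :=
  (forall k a x, x \in filt F k -> mul a x \in filt F k) /\
  (forall k a x y, x \in filt F k -> y \in filt F k ->
     form F k (gr F k (mul a x)) (gr F k y)
       = form F k (gr F k x) (gr F k (mul a y))).

Definition mixed_frobenius_algebra (K : fieldType) (A : vectType K)
    (mul : A -> A -> A) (F : nondegenerate_filtration A) : Prop :=
  comm_unital_algebra mul /\ frobenius_filtration mul F.

(* K[lambda] and K[lambda, lambda^-1] inside K(lambda).                       *)
Section Laurent.
Variable K : fieldType.

Definition tofr (p : {poly K}) : {fraction {poly K}} := FracField.tofrac p.
Definition lam : {fraction {poly K}} := tofr 'X.
Definition is_poly (f : {fraction {poly K}}) : Prop := exists p, f = tofr p.
Definition is_laurent (f : {fraction {poly K}}) : Prop :=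
  exists p n, f = tofr p / lam ^+ n.

(* If f = n / d is a Laurent polynomial then lambda^s * f is a polynomial for *)
(* s = size d, and the residue is its coefficient of index s - 1.             *)
(* See res0E for the value on Laurent polynomials; the value elsewhere is     *)
(* irrelevant.                                                                *)
Definition res0 (f : {fraction {poly K}}) : K :=
  let n := \n_(repr f) in let d := \d_(repr f) in
  (('X^(size d) * n) %/ d)`_(size d).-1.

Lemma tofr_numden (f : {fraction {poly K}}) :
  f * tofr \d_(repr f) = tofr \n_(repr f).
Proof.
rewrite /tofr -{1}[f]reprK; unlock FracField.tofrac.
apply/eqP; rewrite !piE FracField.equivfE.
case: (repr f) => -[n d] /= d0.
by rewrite !numden_Ratio ?mulf_neq0 ?oner_neq0 //= !mulr1 mulrC.
Qed.

Lemma res0E (p : {poly K}) (n : nat) :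
  res0 (tofr p / lam ^+ n) = if n is m.+1 then p`_m else 0.
Proof.
rewrite /res0; set f := tofr p / lam ^+ n.
have := tofr_numden f.
have := denom_ratioP (repr f).
move: \n_(repr f) \d_(repr f) => a d d0 fad.
have X0 m : tofr ('X^m : {poly K}) != 0 by rewrite tofrac_eq0 -size_poly_eq0 size_polyXn.
have lamE m : lam ^+ m = tofr ('X^m : {poly K}) by rewrite /lam /tofr rmorphXn.
have pd : p * d = a * 'X^n.
  apply/eqP; rewrite -(tofrac_eq (p * d)) !rmorphM /=.
  move: fad; rewrite /f lamE /tofr => <-.
  by rewrite [_ / _ * _]mulrAC divfK.
have [j [e [eX dE]]] := multiplicity_XsubC d 0.
move: eX dE; rewrite d0 polyC0 subr0 /= => e0 dE.
have cop : coprimep e 'X^n.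
  by apply: coprimep_expr; rewrite -['X]subr0 -polyC0 coprimep_XsubC.
have /dvdpP[q aE] : e %| a.
  by rewrite -(Gauss_dvdpl _ cop) -pd dE; apply/dvdp_mull/dvdp_mulr.
have en0 : e != 0 by apply: contraNneq e0 => ->; rewrite root0.
have pq : p * 'X^j = q * 'X^n.
  apply: (mulfI en0); rewrite [LHS]mulrCA -dE pd aE.
  by rewrite mulrA [e * q]mulrC.
have jd : (j < size d)%N.
  by rewrite dE size_mulXn // -[X in (X < _)%N]addn0 ltn_add2l lt0n size_poly_eq0.
have -> : 'X^(size d) * a = q * 'X^(size d - j) * d.
  move: (size d) jd => s js.
  by rewrite aE dE mulrACA -exprD subnK ?(ltnW js) // mulrC.
rewrite mulpK // coefMXn.
have {pq} /(congr1 (fun r : {poly K} => r`_(n + j).-1)) := pq.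
rewrite !coefMXn; move: (size d) jd => s js.
case: n j {cop X0 lamE pd f fad dE} js => [|m] [|j] js /=.
- by rewrite ifT //; lia.
- have -> : ((0 + j.+1).-1 < j.+1)%N by lia.
  have -> : ((0 + j.+1).-1 - 0 = j)%N by lia.
  have -> : (s.-1 - (s - j.+1) = j)%N by lia.
  by move=> <-; case: ifP.
- by rewrite subn0 addn0 ltnS leqnn subn0 => ->; rewrite ifT //; lia.
- have -> : (s.-1 < s - j.+1)%N = false by lia.
  have -> : (m + j.+1 < j.+1)%N = false by lia.
  have -> : (m + j.+1 < m.+1)%N = false by lia.
  have -> : (m + j.+1 - m.+1 = j)%N by lia.
  have -> : (s.-1 - (s - j.+1) = j)%N by lia.
  by rewrite addnK => ->.
Qed.

End Laurent.

(* H (x)_K K[lambda], in the coordinates given by a basis of H: injp is       *)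
(* h |-> h (x) 1 (see polyext_univ for the universal property), and red is    *)
(* the projection onto H = polyext K H / lambda polyext K H (see red_eq0).    *)
Notation polyext K H := 'rV[{poly K}]_(\dim {: H}).

Section PolyExt.
Variables (K : fieldType) (H : vectType K).
Implicit Types (h : H) (X Y : polyext K H).

Definition injp h : polyext K H :=
  map_mx polyC (rVof (vbasis {: H}) h).
Definition red X : H :=
  vecof (vbasis {: H}) (map_mx (horner_eval 0) X).

Lemma red_linear p X Y : red (p *: X + Y) = p.[0] *: red X + red Y.
Proof.
rewrite /red -linearP; congr vecof.
by apply/rowP => i; rewrite !mxE /horner_eval hornerD hornerM.
Qed.

Lemma injpK : cancel injp red.
Proof.
move=> h; rewrite /red /injp -[RHS](rVofK (vbasisP {: H})).
by congr vecof; apply/rowP => i; rewrite !mxE /horner_eval hornerC.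
Qed.

Lemma red_eq0 X : red X = 0 <-> exists Y, X = 'X *: Y.
Proof.
split=> [X0|[Y ->]]; last first.
  by rewrite -['X *: Y]addr0 red_linear hornerX scale0r add0r /red map_mx0 linear0.
exists (map_mx (fun p : {poly K} => p %/ 'X) X); apply/rowP => i; rewrite !mxE.
move/eqP: X0; rewrite (vecof_eq0 (vbasisP {: H})) => /eqP/rowP/(_ i).
rewrite !mxE /horner_eval => X0; rewrite mulrC divpK //.
by rewrite -['X]subr0 -polyC0 dvdp_XsubCl; apply/rootP.
Qed.

Lemma injp_linear a h h' : injp (a *: h + h') = a%:P *: injp h + injp h'.
Proof.
by rewrite /injp linearP; apply/rowP => i; rewrite !mxE polyCD polyCM.
Qed.

Lemma polyext_univ (M : lmodType {poly K}) (f : H -> M) :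
  (forall a h h', f (a *: h + h') = a%:P *: f h + f h') ->
  (exists F : {linear polyext K H -> M}, forall h, F (injp h) = f h) /\
  (forall F F' : {linear polyext K H -> M},
     (forall h, F (injp h) = F' (injp h)) -> F =1 F').
Proof.
move=> fL; set e := vbasis {: H}.
have eP : basis_of {: H} e := vbasisP _.
have XE X : X = \sum_i X 0 i *: injp e`_i.
  rewrite {1}[X]row_sum_delta; apply: eq_bigr => i _.
  by rewrite /injp (rVofE eP) map_delta_mx.
split=> [|F F' FE X]; last first.
  by rewrite [X]XE !linear_sum; apply: eq_bigr => i _; rewrite !linearZ FE.
pose F (X : polyext K H) := \sum_i X 0 i *: f e`_i.
have FL : linear F.
  move=> p X Y; rewrite /F scaler_sumr -big_split /=; apply: eq_bigr => i _.
  by rewrite !mxE scalerDl scalerA.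
pose FF := GRing.isLinear.Build _ _ _ _ F FL.
pose G : {linear polyext K H -> M} := HB.pack F FF.
exists G => h; rewrite /= /F.
have f0 : f 0 = 0.
  by have := fL 1 0 0; rewrite scale1r addr0 => /eqP; rewrite polyC1 scale1r -subr_eq0 opprD addNKr oppr_eq0 => /eqP.
have fZ a v : f (a *: v) = a%:P *: f v by rewrite -[a *: v]addr0 fL f0 addr0.
have fD u v : f (u + v) = f u + f v by rewrite -[u]scale1r fL polyC1 !scale1r.
have -> : h = \sum_i rVof e h 0 i *: e`_i.
  by rewrite -[LHS](rVofK eP).
rewrite (big_morph f fD f0); apply: eq_bigr => i _; rewrite fZ !mxE.
by congr (_%:P *: _); rewrite -[in RHS](rVofK eP h).
Qed.

Definition induced_mul (mul : polyext K H -> polyext K H -> polyext K H) (x y : H) : H :=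
  red (mul (injp x) (injp y)).

Lemma induced_mul_red (mul : polyext K H -> polyext K H -> polyext K H) :
  bilinear_for *:%R *:%R mul ->
  forall X Y, induced_mul mul (red X) (red Y) = red (mul X Y).
Proof.
move=> [mull mulr].
have mulL p X X' Y : mul (p *: X + X') Y = p *: mul X Y + mul X' Y.
  exact: (mull Y p X X').
have mulR p X Y Y' : mul X (p *: Y + Y') = p *: mul X Y + mul X Y'.
  exact: (mulr X p Y Y').
have redP X : exists Y, injp (red X) = 'X *: Y + X.
  have [|Y YE] := (red_eq0 (injp (red X) - X)).1; last by exists Y; rewrite -YE subrK.
  by rewrite -scaleN1r addrC red_linear injpK hornerN hornerC scaleN1r addNr.
move=> X Y; rewrite /induced_mul.
have [X' ->] := redP X; have [Y' ->] := redP Y.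
by rewrite mulL red_linear hornerX scale0r add0r mulR red_linear hornerX scale0r add0r.
Qed.

End PolyExt.

Section LocalizedMetric.
Variables (K : fieldType) (M : lmodType {poly K}).
Implicit Type g : M -> M -> {fraction {poly K}}.

Definition is_basis m (e : 'I_m -> M) : Prop :=
  forall x, exists! c : 'rV[{poly K}]_m, x = \sum_i c 0 i *: e i.

Definition laurent_invertible m (G : 'M[{fraction {poly K}}]_m) : Prop :=
  exists B : 'M_m, [/\ forall i j, is_laurent (B i j), G *m B = 1%:M
                     & B *m G = 1%:M].

Record localized_metric g : Prop := {
  lm_laurent : forall x y, is_laurent (g x y);
  lm_linear : forall p x x' y, g (p *: x + x') y = tofr p * g x y + g x' y;
  lm_sym : forall x y, g x y = g y x;
  lm_unimodular : exists m (e : 'I_m -> M), is_basis e /\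
    laurent_invertible (\matrix_(i, j) g (e i) (e j))
}.

Definition lattice g (k : int) (x : M) : Prop :=
  forall y, is_poly (lam K ^ k * g x y).

End LocalizedMetric.

(* This determines F (see induced_filtration_uniq); the last clause includes  *)
(* the independence of the choice of the lifts X and Y.                       *)
Definition induced_filtration (K : fieldType) (H : vectType K)
    (g : polyext K H -> polyext K H -> {fraction {poly K}})
    (F : nondegenerate_filtration H) : Prop :=
  (forall k x, x \in filt F k <-> exists2 X, lattice g k X & red X = x) /\
  (forall k X Y, lattice g k X -> lattice g k Y ->
     form F k (gr F k (red X)) (gr F k (red Y))
       = res0 (lam K ^ (k - 1) * g X Y)).

Lemma induced_filtration_uniq (K : fieldType) (H : vectType K)
    (g : polyext K H -> polyext K H -> {fraction {poly K}})
    (F F' : nondegenerate_filtration H) :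
  induced_filtration g F -> induced_filtration g F' ->
  filt F =1 filt F' /\
  forall k x y, x \in filt F k -> y \in filt F k ->
    form F k (gr F k x) (gr F k y) = form F' k (gr F' k x) (gr F' k y).
Proof.
move=> [FI Fg] [FI' Fg']; split=> [k|k x y /FI[X IX <-] /FI[Y IY <-]].
  by apply/vspaceP => x; apply/idP/idP => [/FI/FI'|/FI'/FI].
by rewrite Fg // Fg'.
Qed.

(* Main.v *)
Require Import Defs.
From mathcomp Require Import all_boot all_order all_algebra.
From mathcomp Require Import zify.

(* The only nontrivial point is that g_k is nondegenerate. Over the local ring of *)
(* K[lambda] at 0 the Gram matrix of g has a Smith normal form, which gives      *)
(* families E, F in M = H[lambda], each a basis of M locally at 0, such that      *)
(* g (E i) (F j) = delta_ij lambda^(a i) u_i with u_i(0) != 0. Then I_k is        *)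
(* spanned by the classes of the E i with k + a i >= 0. If x = sum_i c_i E_i in   *)
(* the lattice of index k has residue 0 against every F j with k + a j = 0, which *)
(* also lies in that lattice, then c_j(0) = 0 for these j, so the class of x is   *)
(* in I_(k-1). Invariance of g makes each lattice an ideal, and yields the        *)
(* invariance of g_k by taking lifts.                                             *)

Set Implicit Arguments.
Unset Strict Implicit.
Unset Printing Implicit Defensive.

Import Order.TTheory GRing.Theory Num.Theory.
Local Open Scope ring_scope.

(** Everything that defines I_k and g_k is visible locally at 0: a Laurent polynomial regular at 0
    is a polynomial ([is_laurent_local]), and the residue that defines g_k is the constant term of
    lambda^k g ([res0_lam_pred]). So it suffices to diagonalize g over the local ring at 0. The
    Smith form ([local_smith], [dual_pair_exists]) changes rows and columns independently and
    therefore yields two families instead of one orthogonal basis, which may fail to exist in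
    characteristic 2. A pairing of two families is enough: [dp_coef] reads the coordinates of a
    vector from it, which gives the filtration ([red_ifilt]) and the nondegeneracy ([red_res0_eq0]);
    [res0_indep] makes g_k well defined. *)

(** * Smith normal form over the local ring of K[lambda] at 0 *)

Section LocalSmith.
Variable K : fieldType.

Lemma horner0_dvdX (p : {poly K}) : p.[0] = 0 -> exists q, p = 'X * q.
Proof.
move=> p0; exists (p %/ 'X); rewrite mulrC divpK //.
by rewrite -['X]subr0 -polyC0 dvdp_XsubCl; apply/rootP.
Qed.

Lemma coprimep_Xn_horner0 (p : {poly K}) n : p.[0] != 0 -> coprimep p 'X^n.
Proof.
move=> p0; apply: coprimep_expr.
by rewrite -['X]subr0 -polyC0 coprimep_XsubC.
Qed.

Lemma horner0_tperm_mx n (i j : 'I_n) :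
  (\det (tperm_mx i j : 'M[{poly K}]_n)).[0] != 0.
Proof.
rewrite /tperm_mx det_perm; case: (perm.odd_perm _).
  by rewrite expr1 hornerN hornerC oppr_eq0 oner_eq0.
by rewrite expr0 hornerC oner_eq0.
Qed.

(* If every entry vanishes at 0, divide the matrix by 'X, which lowers the degree *)
(* of the determinant. Otherwise use an entry u with u(0) != 0 as a pivot: rows   *)
(* and columns may be multiplied by u, so no division is needed to clear them.    *)
Lemma local_smith m (A : 'M[{poly K}]_m) : \det A != 0 ->
  exists P Q d, [/\ (\det P).[0] != 0, (\det Q).[0] != 0
                  & P *m A *m Q = diag_mx d].
Proof.
elim: m A => [|m IHm] A dA.
  exists 1%:M, 1%:M, 0; split; rewrite ?det1 ?hornerC ?oner_eq0 //.
  by apply/matrixP=> -[].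
have [s] := ubnP (size (\det A)); elim: s A dA => // s IHs A dA sA.
have [A0|[i [j Aij]]] : (forall i j, (A i j).[0] = 0) \/
    exists i j, (A i j).[0] != 0.
  case: (pickP (fun ij => (A ij.1 ij.2).[0] != 0)) => [[i j] /= ?|A0].
    by right; exists i, j.
  by left=> i j; apply/eqP; move: (A0 (i, j)) => /negbFE.
- have [B AB] : exists B, A = 'X *: B.
    exists (\matrix_(i, j) (A i j %/ 'X)); apply/matrixP=> i j.
    rewrite !mxE; have [q ->] := horner0_dvdX (A0 i j).
    by rewrite mulKp ?polyX_eq0 // mulrC.
  move: dA sA; rewrite AB detZ mulf_eq0 negb_or => /andP[_ dB] sB.
  have [|P [Q [d [dP dQ PBQ]]]] := IHs B dB.
    rewrite -ltnS; apply: leq_trans sB; rewrite mulrC size_mulXn //.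
    by rewrite ltnS addSn ltnS leq_addl.
  exists P, Q, ('X *: d); split=> //.
  by rewrite -scalemxAr -scalemxAl PBQ linearZ.
pose B : 'M[{poly K}]_(1 + m) :=
  (tperm_mx i 0 : 'M_(1 + m)) *m A *m (tperm_mx j 0 : 'M_(1 + m)).
have uE : ulsubmx B = (A i j)%:M.
  apply/rowP=> k; rewrite /B -xcolE -xrowE [k]ord1 !mxE /= mulr1n.
  have -> : lshift m (0 : 'I_1) = 0 by apply: val_inj.
  by rewrite !perm.tpermR.
set u := A i j in Aij uE *.
pose r := ursubmx B; pose c := dlsubmx B; pose D := drsubmx B.
have BE : B = block_mx u%:M r c D by rewrite -uE submxK.
pose L : 'M[{poly K}]_(1 + m) := block_mx 1%:M 0 (- c) u%:M.
pose R : 'M[{poly K}]_(1 + m) := block_mx 1%:M (- r) 0 u%:M.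
(* [u *: D - c *m r] is u times the Schur complement of u; the outer factor u comes from the column
   scaling in [R]. *)
pose S := u *: (u *: D - c *m r).
have LBR : L *m B *m R = block_mx u%:M 0 0 S.
  rewrite BE !mulmx_block !mul1mx !mul0mx !mulmx1 !mulmx0 !addr0.
  rewrite !mulNmx !mulmxN !mul_mx_scalar !mul_scalar_mx.
  by rewrite !addNr mul0mx oppr0 add0r addrC.
have u0 : u != 0 by apply: contraNneq Aij => ->; rewrite horner0.
have dL : \det L = u ^+ m by rewrite det_lblock det1 det_scalar mul1r.
have dR : \det R = u ^+ m by rewrite det_ublock det1 det_scalar mul1r.
have [|P [Q [d [dP dQ PSQ]]]] := IHm S.
  have : \det (L *m B *m R) != 0.
    rewrite !det_mulmx dL dR !mulf_neq0 ?expf_neq0 //.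
      by apply: contraNneq (horner0_tperm_mx i 0) => ->; rewrite horner0.
    by apply: contraNneq (horner0_tperm_mx j 0) => ->; rewrite horner0.
  by rewrite LBR det_ublock mulf_eq0 negb_or => /andP[].
have det_diag1 (C : 'M[{poly K}]_m) :
    \det (block_mx 1%:M 0 0 C : 'M_(1 + m)) = \det C.
  by rewrite det_ublock det1 mul1r.
exists ((block_mx 1%:M 0 0 P : 'M_(1 + m)) *m L *m (tperm_mx i 0 : 'M_(1 + m))).
exists ((tperm_mx j 0 : 'M_(1 + m)) *m R *m (block_mx 1%:M 0 0 Q : 'M_(1 + m))).
exists (row_mx u%:M d : 'rV_(1 + m)); split.
- rewrite !det_mulmx dL det_diag1 !hornerM horner_exp.
  by rewrite !mulf_neq0 ?expf_neq0 ?horner0_tperm_mx.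
- rewrite !det_mulmx dR det_diag1 !hornerM horner_exp.
  by rewrite !mulf_neq0 ?expf_neq0 ?horner0_tperm_mx.
transitivity (block_mx (diag_mx (u%:M : 'rV_1)) 0 0 (diag_mx d));
  last by rewrite -(diag_mx_row (u%:M : 'rV_1) d).
transitivity ((block_mx 1%:M 0 0 P : 'M_(1 + m)) *m (L *m B *m R) *m
  (block_mx 1%:M 0 0 Q : 'M_(1 + m))).
  by rewrite /B !mulmxA.
rewrite LBR !mulmx_block !(mul1mx, mulmx1, mul0mx, mulmx0, addr0, add0r) PSQ.
suff -> : diag_mx (u%:M : 'rV[{poly K}]_1) = u%:M by [].
by apply/matrixP=> a b; rewrite ![a]ord1 ![b]ord1 !mxE.
Qed.
End LocalSmith.

(** * Poles, orders at 0 and residues of Laurent polynomials *)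

Section Laurent.
Variable K : fieldType.
Implicit Types (p v c u : {poly K}) (f : {fraction {poly K}}).

Lemma tofrD p q : tofr (p + q) = tofr p + tofr q.
Proof. exact: rmorphD. Qed.

Lemma tofrM p q : tofr (p * q) = tofr p * tofr q.
Proof. exact: rmorphM. Qed.

Lemma tofr_inj : injective (@tofr K).
Proof. by move=> p q /eqP; rewrite tofrac_eq => /eqP. Qed.

Lemma lam_neq0 : lam K != 0.
Proof. by rewrite /lam /tofr tofrac_eq0 polyX_eq0. Qed.

Lemma tofrXn n : tofr 'X^n = lam K ^+ n.
Proof. by rewrite /lam /tofr rmorphXn. Qed.

Lemma is_polyD f f' : is_poly f -> is_poly f' -> is_poly (f + f').
Proof. by move=> [p ->] [q ->]; exists (p + q); rewrite tofrD. Qed.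

Lemma is_polyM p f : is_poly f -> is_poly (tofr p * f).
Proof. by move=> [q ->]; exists (p * q); rewrite tofrM. Qed.

Lemma is_poly_lam_ge0 (e : int) p : 0 <= e -> is_poly (lam K ^ e * tofr p).
Proof.
by case: e => // n _; exists ('X^n * p); rewrite tofrM tofrXn.
Qed.

(** Since u is a unit at 0, only a zero of c can cancel the pole of lambda^e. *)
Lemma is_poly_lam_lt0 (e : int) c u : e < 0 -> u.[0] != 0 ->
  is_poly (tofr c * (lam K ^ e * tofr u)) -> c.[0] = 0.
Proof.
case: e => // n _ u0 [p pE].
have /tofr_inj : tofr (c * u) = tofr (p * 'X^(n.+1)).
  rewrite !tofrM -pE tofrXn NegzE -exprnN mulrA mulrAC -mulrA -mulrA.
  by rewrite mulKf // expf_neq0 ?lam_neq0.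
move=> /(congr1 (horner^~ 0)); rewrite !hornerM hornerXn expr0n mulr0.
by move/eqP; rewrite mulf_eq0 (negbTE u0) orbF => /eqP.
Qed.

Lemma is_laurent_lam (e : int) f : is_laurent f -> is_laurent (lam K ^ e * f).
Proof.
move=> [p [n ->]]; case: e => k.
  by exists ('X^k * p), n; rewrite tofrM tofrXn mulrA.
by exists p, (k.+1 + n)%N; rewrite exprD invfM NegzE -exprnN mulrCA.
Qed.

(** The intersection of K[lambda, lambda^-1] with the local ring at 0 is K[lambda]: v is coprime to
    the power of lambda in the denominator. *)
Lemma is_laurent_local v f : is_laurent f -> v.[0] != 0 ->
  is_poly (tofr v * f) -> is_poly f.
Proof.
move=> [q [n ->]] v0 [p pE].
have /tofr_inj vq : tofr (v * q) = tofr (p * 'X^n).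
  by rewrite !tofrM -pE tofrXn mulrA divfK // expf_neq0 ?lam_neq0.
have : 'X^n %| q.
  rewrite -(@Gauss_dvdpr _ _ v) 1?coprimep_sym ?coprimep_Xn_horner0 //.
  by rewrite vq dvdp_mulIr.
by case/dvdpP=> r ->; exists r; rewrite tofrM tofrXn mulfK // expf_neq0 ?lam_neq0.
Qed.

Lemma res0_lam_pred (k : int) f p :
  lam K ^ k * f = tofr p -> res0 (lam K ^ (k - 1) * f) = p.[0].
Proof.
move=> fE; rewrite addrC expfzDr ?lam_neq0 // exprN1 -mulrA fE mulrC -[lam K]expr1.
by rewrite res0E horner_coef0.
Qed.

End Laurent.

(** * Locally dual families for a localized metric *)

Section DualPair.
Variables (K : fieldType) (M : lmodType {poly K}).

(* The family e generates the localization of M at 0.                             *)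
Definition locally_spans m (e : 'I_m -> M) : Prop :=
  forall X, exists v (c : 'I_m -> {poly K}),
    v.[0] = 1 /\ v *: X = \sum_i c i *: e i.

Record dual_pair (g : M -> M -> {fraction {poly K}}) m (E F : 'I_m -> M)
    (a : 'I_m -> int) (u : 'I_m -> {poly K}) : Prop := {
  dp_unit : forall i, (u i).[0] != 0;
  dp_form : forall i j, g (E i) (F j) = (lam K ^ a i * tofr (u i)) *+ (i == j);
  dp_spanl : locally_spans E;
  dp_spanr : locally_spans F
}.

(** Cramer's rule: the adjugate inverts [P] up to the factor [\det P], which is a unit at 0. *)
Lemma basis_locally_spans m (e : 'I_m -> M) (P : 'M_m) :
  is_basis e -> (\det P).[0] != 0 ->
  locally_spans (fun i => \sum_j P i j *: e j).
Proof.
move=> eP dP X; have [x [-> _]] := eP X.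
set s := (\det P).[0] in dP.
exists ((s^-1)%:P * \det P), (fun i => (s^-1)%:P * (x *m \adj P) 0 i).
split; first by rewrite hornerM hornerC mulVf.
under [RHS]eq_bigr do rewrite -scalerA scaler_sumr.
rewrite -scalerA -scaler_sumr exchange_big /= scaler_sumr; congr (_ *: _).
apply: eq_bigr => j _.
under eq_bigr do rewrite scalerA.
rewrite -scaler_suml scalerA; congr (_ *: _).
have /(congr1 (fun A : 'rV_m => A 0 j)) : x *m \adj P *m P = \det P *: x.
  by rewrite -mulmxA mul_adj_mx mul_mx_scalar.
by rewrite !mxE => <-.
Qed.

Variable g : M -> M -> {fraction {poly K}}.
Hypothesis gP : localized_metric g.

Lemma lm_sumZ I (r : seq I) (c : I -> {poly K}) (e : I -> M) Y :
  g (\sum_(i <- r) c i *: e i) Y = \sum_(i <- r) tofr (c i) * g (e i) Y.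
Proof.
have g0 : g 0 Y = 0.
  have := lm_linear gP 1 0 0 Y; rewrite scale1r addr0 /tofr rmorph1 mul1r.
  by move=> /(congr1 (fun t => t - g 0 Y)); rewrite subrr addrK.
elim: r => [|i r IHr]; first by rewrite !big_nil.
by rewrite !big_cons (lm_linear gP) IHr.
Qed.

Lemma lmZ p X Y : g (p *: X) Y = tofr p * g X Y.
Proof.
by have := lm_sumZ [:: tt] (fun=> p) (fun=> X) Y; rewrite !big_seq1.
Qed.

(** Multiply the Gram matrix by lambda^N to clear denominators and take its Smith form. If the i-th
    diagonal entry is lambda^w u with u(0) nonzero, then a i = w - N. *)
Lemma dual_pair_exists : exists m (E F : 'I_m -> M) a u, dual_pair g E F a u.
Proof.
have [m [e [eP [B [_ GB _]]]]] := lm_unimodular gP.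
have [p gp] : exists p : 'I_m * 'I_m -> {poly K} * nat,
    forall ij, g (e ij.1) (e ij.2) = tofr (p ij).1 / lam K ^+ (p ij).2.
  apply: (@fin_all_exists _ (fun=> ({poly K} * nat)%type)
    (fun ij q => g (e ij.1) (e ij.2) = tofr q.1 / lam K ^+ q.2)) => ij.
  by have [q [n qn]] := lm_laurent gP (e ij.1) (e ij.2); exists (q, n).
pose N := (\sum_ij (p ij).2)%N.
pose A := \matrix_(i, j) ((p (i, j)).1 * 'X^(N - (p (i, j)).2)).
have AE i j : tofr (A i j) = lam K ^+ N * g (e i) (e j).
  have nN : ((p (i, j)).2 <= N)%N by rewrite /N (bigD1 (i, j)) //= leq_addr.
  rewrite mxE tofrM tofrXn (gp (i, j)) /= -{2}(subnK nN) exprD.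
  by rewrite mulrACA mulfV ?expf_neq0 ?lam_neq0 // mulr1 mulrC.
have dA : \det A != 0.
  rewrite -tofrac_eq0 -det_map_mx.
  have -> : map_mx (FracField.tofrac (R:=_)) A
      = lam K ^+ N *: \matrix_(i, j) g (e i) (e j).
    by apply/matrixP=> i j; rewrite !mxE -AE mxE.
  (* Unimodularity of g enters here: the Gram matrix has an inverse. *)
  rewrite detZ mulf_neq0 ?expf_neq0 ?lam_neq0 //.
  move/(congr1 determinant): GB; rewrite det_mulmx det1 => GB1.
  by apply: contra_eq_neq GB1 => ->; rewrite mul0r eq_sym oner_eq0.
have [P [Q [d [dP dQ PAQ]]]] := local_smith dA.
have d0 i : d 0 i != 0.
  have : \det (P *m A *m Q) != 0.
    rewrite !det_mulmx !mulf_neq0 //.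
      by apply: contraNneq dP => ->; rewrite horner0.
    by apply: contraNneq dQ => ->; rewrite horner0.
  by rewrite PAQ det_diag => /prodf_neq0; apply.
have [w wP] : exists w : 'I_m -> nat * {poly K}, forall i,
    (w i).2.[0] != 0 /\ d 0 i = (w i).2 * 'X^((w i).1).
  apply: (@fin_all_exists _ (fun=> (nat * {poly K})%type)
    (fun i w => w.2.[0] != 0 /\ d 0 i = w.2 * 'X^(w.1))) => i.
  have [k [q]] := multiplicity_XsubC (d 0 i) 0.
  by rewrite d0 polyC0 subr0 => q0 dE; exists (k, q).
exists m, (fun i => \sum_j P i j *: e j), (fun i => \sum_j Q^T i j *: e j).
exists (fun i => (w i).1%:Z - N%:Z), (fun i => (w i).2).
split=> [i|i j||]; last 2 first.
- exact: basis_locally_spans.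
- by apply: basis_locally_spans => //; rewrite det_tr.
- by case: (wP i).
have gE : lam K ^+ N * g (\sum_j P i j *: e j) (\sum_k Q^T j k *: e k)
    = tofr ((P *m A *m Q) i j).
  rewrite lm_sumZ mulmxE -mulrA -mulmxE mxE /tofr rmorph_sum mulr_sumr /=.
  apply: eq_bigr => l _; rewrite mulrCA rmorphM; congr (_ * _).
  rewrite (lm_sym gP) lm_sumZ mxE rmorph_sum mulr_sumr /=.
  apply: eq_bigr => k _.
  by rewrite mxE (lm_sym gP) mulrCA -AE mulrC rmorphM.
have lN : lam K ^+ N != 0 by rewrite expf_neq0 ?lam_neq0.
apply: (mulfI lN); rewrite gE PAQ mxE.
case: eqP => _; last by rewrite !mulr0n mulr0 /tofr rmorph0.
have [_ ->] := wP i; rewrite !mulr1n expfzDr ?lam_neq0 // tofrM tofrXn.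
by rewrite -exprnN [RHS]mulrC -!mulrA [_ * lam K ^+ N]mulrC mulKf // mulrC.
Qed.
End DualPair.

(** * The lattices of g in terms of a dual pair *)

Section Lattice.
Variables (K : fieldType) (M : lmodType {poly K}).
Variable g : M -> M -> {fraction {poly K}}.
Hypothesis gP : localized_metric g.

Lemma lattice_lin k p X Y :
  lattice g k X -> lattice g k Y -> lattice g k (p *: X + Y).
Proof.
move=> Xk Yk Z; rewrite (lm_linear gP) mulrDr mulrCA.
by apply: is_polyD (Yk Z); apply: is_polyM.
Qed.

Lemma lattice0 k : lattice g k 0.
Proof.
move=> Z; have := lm_sumZ gP [::] (fun=> 0) (fun _ : unit => 0) Z.
by rewrite !big_nil => ->; rewrite mulr0; exists 0; rewrite /tofr rmorph0.
Qed.

Lemma lattice_sum k I (r : seq I) (c : I -> {poly K}) (e : I -> M) :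
  (forall i, lattice g k (e i)) -> lattice g k (\sum_(i <- r) c i *: e i).
Proof.
move=> ek; elim: r => [|i r IHr]; first by rewrite big_nil; apply: lattice0.
by rewrite big_cons; apply: lattice_lin.
Qed.

Lemma lattice_le k X : lattice g (k - 1) X -> lattice g k X.
Proof.
move=> Xk Y; have [p pE] := Xk Y; exists ('X * p).
by rewrite tofrM -pE mulrA addrC expfzDr ?lam_neq0 // exprN1 mulVKf ?lam_neq0.
Qed.

Lemma dual_pair_sym m (E F : 'I_m -> M) a u :
  dual_pair g E F a u -> dual_pair g F E a u.
Proof.
case=> uU EF sE sF; split=> // i j.
by rewrite (lm_sym gP) EF eq_sym; case: eqP => [->|].
Qed.

Section Pair.
Variables (m : nat) (E F : 'I_m -> M) (a : 'I_m -> int) (u : 'I_m -> {poly K}).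
Hypothesis dP : dual_pair g E F a u.

(** Pairing with [F j] kills every term of the expansion except the j-th. *)
Lemma dp_coef v c X j : v *: X = \sum_i c i *: E i ->
  tofr v * g X (F j) = tofr (c j) * (lam K ^ a j * tofr (u j)).
Proof.
move=> XE; rewrite -(lmZ gP) XE (lm_sumZ gP) (bigD1 j) //= big1 => [|i ij].
  by rewrite addr0 (dp_form dP) eqxx.
by rewrite (dp_form dP) (negbTE ij) mulr0.
Qed.

(** After multiplication by v, which is a unit at 0, lambda^k g against any vector is a polynomial
    multiple of lambda^(k + a i); [is_laurent_local] then removes v. *)
Lemma dp_lattice k i : 0 <= k + a i -> lattice g k (F i).
Proof.
move=> ki Y; have [v [c [v1 YE]]] := dp_spanl dP Y.
apply: (@is_laurent_local _ v); first exact/is_laurent_lam/(lm_laurent gP).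
  by rewrite v1 oner_eq0.
rewrite (lm_sym gP) mulrCA (dp_coef _ YE) mulrCA; apply: is_polyM.
by rewrite mulrA -expfzDr ?lam_neq0 //; apply: is_poly_lam_ge0.
Qed.

Lemma dp_lattice_coef k v c X j :
  v *: X = \sum_i c i *: E i -> lattice g k X -> k + a j < 0 -> (c j).[0] = 0.
Proof.
move=> XE Xk kj; apply: (is_poly_lam_lt0 kj (dp_unit dP j)).
rewrite expfzDr ?lam_neq0 // -mulrA mulrCA -(dp_coef j XE) mulrCA.
exact/is_polyM/Xk.
Qed.

(** When k + a j = 0 the powers of lambda cancel, so the residue is c_j(0) u_j(0). *)
Lemma dp_lattice_res k v c X j :
  v.[0] = 1 -> v *: X = \sum_i c i *: E i -> lattice g k X -> k + a j = 0 ->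
  res0 (lam K ^ (k - 1) * g X (F j)) = 0 -> (c j).[0] = 0.
Proof.
move=> v1 XE Xk kj; have [p pE] := Xk (F j); rewrite (res0_lam_pred pE) => p0.
have /tofr_inj : tofr (v * p) = tofr (c j * u j).
  rewrite !tofrM -pE mulrCA (dp_coef j XE) mulrCA; congr (_ * _).
  by rewrite mulrA -expfzDr ?lam_neq0 // kj mul1r.
move/(congr1 (horner^~ 0)); rewrite !hornerM p0 mulr0 => /esym/eqP.
by rewrite mulf_eq0 (negbTE (dp_unit dP j)) orbF => /eqP.
Qed.

End Pair.
End Lattice.

(** * The induced filtration and its metrics *)

Section Filtration.
Variables (K : fieldType) (H : vectType K).
Implicit Types X Y : polyext K H.
Variable g : polyext K H -> polyext K H -> {fraction {poly K}}.
Hypothesis gP : localized_metric g.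
Variables (m : nat) (E F : 'I_m -> polyext K H) (a : 'I_m -> int) (u : 'I_m -> {poly K}).
Hypothesis dP : dual_pair g E F a u.

Lemma red0 : red (0 : polyext K H) = 0.
Proof. by apply/red_eq0; exists 0; rewrite scaler0. Qed.

Lemma redD X Y : red (X + Y) = red X + red Y.
Proof. by rewrite -[X]scale1r red_linear hornerC !scale1r. Qed.

Lemma redZ p X : red (p *: X) = p.[0] *: red X.
Proof. by rewrite -[_ *: X]addr0 red_linear red0 addr0. Qed.

Lemma redB X Y : red (X - Y) = red X - red Y.
Proof. by rewrite redD -scaleN1r redZ hornerN hornerC scaleN1r. Qed.

Lemma red_sumZ n (c : 'I_n -> {poly K}) (e : 'I_n -> polyext K H) :
  red (\sum_i c i *: e i) = \sum_i (c i).[0] *: red (e i).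
Proof.
by rewrite (big_morph (@red K H) redD red0); apply: eq_bigr => i _; rewrite redZ.
Qed.

(** The value 0 at the excluded indices keeps the index set ['I_m] independent of k. *)
Definition gens (k : int) (i : 'I_m) : polyext K H :=
  if 0 <= k + a i then E i else 0.
Definition gens_red (k : int) : m.-tuple H := [tuple red (gens k i) | i < m].
Definition ifilt (k : int) : {vspace H} := <<gens_red k>>%VS.
Definition lift (k : int) (h : H) : polyext K H :=
  \sum_i (coord (gens_red k) i h)%:P *: gens k i.

Lemma lattice_gens k i : lattice g k (gens k i).
Proof.
rewrite /gens; case: ifP => [ki|_]; last exact: lattice0.
exact: (dp_lattice gP (dual_pair_sym gP dP)).
Qed.

Lemma lattice_lift k h : lattice g k (lift k h).
Proof. exact/(lattice_sum gP)/lattice_gens. Qed.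

Lemma red_lift k h : h \in ifilt k -> red (lift k h) = h.
Proof.
move=> hk; rewrite red_sumZ [RHS](coord_span hk); apply: eq_bigr => i _.
by rewrite hornerC (nth_map i) ?size_enum_ord // nth_ord_enum.
Qed.

(** As v(0) = 1, reduction at 0 turns the local expansion into one of [red X] with coefficients
    c_i(0). *)
Lemma mem_ifilt_sum k v c X : v.[0] = 1 -> v *: X = \sum_i c i *: E i ->
  (forall i, k + a i < 0 -> (c i).[0] = 0) -> red X \in ifilt k.
Proof.
move=> v1 XE c0; have -> : red X = \sum_i (c i).[0] *: red (E i).
  by rewrite -red_sumZ -XE redZ v1 scale1r.
apply: memv_suml => i _; have [ki|ki] := leP 0 (k + a i); last first.
  by rewrite c0 // scale0r mem0v.
apply/memvZ/memv_span/mapP; exists i; first by rewrite mem_enum.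
by rewrite /gens ki.
Qed.

Lemma red_ifilt k X : lattice g k X -> red X \in ifilt k.
Proof.
move=> Xk; have [v [c [v1 XE]]] := dp_spanl dP X.
by apply: (mem_ifilt_sum v1 XE) => i; apply: (dp_lattice_coef gP dP XE Xk).
Qed.

Lemma ifiltP k x : x \in ifilt k <-> exists2 X, lattice g k X & red X = x.
Proof.
split=> [xk|[X Xk <-]]; last exact: red_ifilt.
by exists (lift k x); [apply: lattice_lift | apply: red_lift].
Qed.

Lemma ifilt_le k : (ifilt (k - 1) <= ifilt k)%VS.
Proof.
by apply/subvP=> x /ifiltP[X /lattice_le Xk <-]; apply: red_ifilt.
Qed.

Lemma a_bounded : exists N : nat, forall i, - N%:Z <= a i <= N%:Z.
Proof.
exists (\sum_i `|a i|)%N => i.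
have : (`|a i| <= \sum_i `|a i|)%N by rewrite (bigD1 i) //= leq_addr.
lia.
Qed.

Lemma ifilt_full : exists k0 : int, forall k, k0 <= k -> ifilt k = fullv.
Proof.
have [N aN] := a_bounded; exists N%:Z => k Nk.
apply/eqP; rewrite eqEsubv subvf; apply/subvP => h _.
have [v [c [v1 XE]]] := dp_spanl dP (injp h).
rewrite -[h]injpK; apply: (mem_ifilt_sum v1 XE) => i.
by have := aN i; lia.
Qed.

Lemma ifilt_zero : exists k0 : int, forall k, k <= k0 -> ifilt k = 0%VS.
Proof.
have [N aN] := a_bounded; exists (- N%:Z - 1) => k Nk.
apply/eqP; rewrite -subv0; apply/span_subvP => h /mapP[i _ ->].
by rewrite /gens ifF ?red0 ?mem0v //; have := aN i; lia.
Qed.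

Lemma latticeR k X Y : lattice g k Y -> is_poly (lam K ^ k * g X Y).
Proof. by rewrite (lm_sym gP); apply. Qed.

(* X - X' = Z + 'X *: W with Z in the lattice of index k - 1, and both Z and      *)
(* 'X *: W have residue 0 against the lattice of index k.                         *)
Lemma res0_indep k X X' Y : lattice g k X -> lattice g k X' -> lattice g k Y ->
    red X - red X' \in ifilt (k - 1) ->
  res0 (lam K ^ (k - 1) * g X Y) = res0 (lam K ^ (k - 1) * g X' Y).
Proof.
move=> Xk X'k Yk; rewrite -redB => /ifiltP[Z Zk ZE].
have [W WE] : exists W, X - (X' + Z) = 'X *: W.
  by apply/red_eq0; rewrite redB redD ZE redB [red X' + _]addrC subrK subrr.
have XE : X = 1 *: (X' + Z) + 'X *: W.
  by rewrite -WE scale1r addrC subrK.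
have [p pE] := Xk Y; have [p' p'E] := X'k Y.
have [q qE] := Zk Y; have [w wE] := latticeR W Yk.
rewrite (res0_lam_pred pE) (res0_lam_pred p'E).
have -> : p = p' + 'X * q + 'X * w.
  apply: tofr_inj; rewrite !tofrD !tofrM -pE -p'E -qE -wE XE (lm_linear gP).
  rewrite (lmZ gP) -[X']scale1r (lm_linear gP) /tofr rmorph1 !mul1r scale1r.
  rewrite !mulrDr; congr (_ + _ + _); last by rewrite mulrCA.
  by rewrite mulrA addrC expfzDr ?lam_neq0 // exprN1 mulVKf ?lam_neq0.
by rewrite !hornerE.
Qed.

(** This is the nondegeneracy of g_k. *)
Lemma red_res0_eq0 k X : lattice g k X ->
    (forall Y, lattice g k Y -> res0 (lam K ^ (k - 1) * g X Y) = 0) ->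
  red X \in ifilt (k - 1).
Proof.
move=> Xk X0; have [v [c [v1 XE]]] := dp_spanl dP X.
apply: (mem_ifilt_sum v1 XE) => i ki.
(* [ki] says k + a i <= 0. The negative case follows from [X] being in the lattice; for k + a i = 0
   the vector [F i] is itself in the lattice of index k and is a valid test vector. *)
have [ki'|ki'] := ltP (k + a i) 0; first exact: (dp_lattice_coef gP dP XE Xk).
apply: (dp_lattice_res gP dP v1 XE Xk); first by lia.
exact/X0/(dp_lattice gP dP).
Qed.

Notation igr k := (subquot (ifilt k) (ifilt (k - 1))).

(** Chosen representatives and lifts make this a function on the quotient; [iform_cls] shows that
    the choices do not matter. *)
Definition iform (k : int) (x y : igr k) : K :=
  res0 (lam K ^ (k - 1) * g (lift k (vsval (repr x))) (lift k (vsval (repr y)))).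

Lemma res0_sym k X Y :
  res0 (lam K ^ (k - 1) * g X Y) = res0 (lam K ^ (k - 1) * g Y X).
Proof. by rewrite (lm_sym gP). Qed.

Lemma iform_cls k X Y : lattice g k X -> lattice g k Y ->
  iform (cls _ _ (red X) : igr k) (cls _ _ (red Y)) = res0 (lam K ^ (k - 1) * g X Y).
Proof.
move=> Xk Yk.
have rep Z : lattice g k Z ->
    red (lift k (vsval (repr (cls _ _ (red Z) : igr k)))) - red Z \in ifilt (k - 1).
  move=> Zk; rewrite red_lift ?subvsP //.
  apply/(cls_eqP _ (subvsP _) (red_ifilt Zk)).
  by rewrite {1}/cls vsvalK reprK.
(* [res0_indep] varies the first argument only, so the second is replaced after swapping by
   symmetry. *)
rewrite /iform (res0_indep (lattice_lift _ _) Xk (lattice_lift _ _) (rep _ Xk)).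
by rewrite res0_sym (res0_indep (lattice_lift _ _) Yk Xk (rep _ Yk)) res0_sym.
Qed.

Lemma igr_surj k (x : igr k) : exists2 X, lattice g k X & x = cls _ _ (red X).
Proof. by have [_ /ifiltP[X Xk <-] ->] := cls_surj x; exists X. Qed.

Lemma cls_red_lin k b X Y : lattice g k X -> lattice g k Y ->
  cls _ _ (red (b%:P *: X + Y)) = b *: cls _ _ (red X) + cls _ _ (red Y) :> igr k.
Proof.
move=> Xk Yk; rewrite red_linear hornerC /cls.
by rewrite linearP subquot_piD -subquot_scale_pi.
Qed.

Lemma iform_metric k : metric (@iform k).
Proof.
have linl b x x' (y : igr k) : iform (b *: x + x') y = b * iform x y + iform x' y :> K.
  have [X Xk ->] := igr_surj x; have [X' X'k ->] := igr_surj x'.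
  have [Y Yk ->] := igr_surj y.
  rewrite -cls_red_lin // !iform_cls //; last exact: (lattice_lin gP).
  have [p pE] := Xk Y; have [p' p'E] := X'k Y.
  rewrite (res0_lam_pred pE) (res0_lam_pred p'E).
  rewrite (@res0_lam_pred _ _ _ (b%:P * p + p')) ?hornerE //.
  by rewrite tofrD tofrM -pE -p'E (lm_linear gP) mulrDr mulrCA.
have sym (x y : igr k) : iform x y = iform y x by rewrite /iform res0_sym.
split=> // [|x x0].
- by split=> [y b x x'|x b y y'] /=; [rewrite linl | rewrite !(sym x) linl].
have [X Xk xE] := igr_surj x; rewrite xE.
have -> : 0 = cls _ _ (red 0) :> igr k.
  have := cls_red_lin (-1) (lattice0 gP k) (lattice0 gP k).
  by rewrite scaler0 addr0 scaleN1r addNr => ->.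
apply/cls_eqP; rewrite ?red0 ?mem0v ?red_ifilt //; rewrite subr0.
apply: red_res0_eq0 => // Y Yk.
by rewrite -iform_cls // -xE x0.
Qed.

Definition induced : nondegenerate_filtration H :=
  Build_nondegenerate_filtration ifilt_le ifilt_full ifilt_zero iform_metric.

Lemma inducedP : induced_filtration g induced.
Proof. by split=> [k x|k X Y]; [apply: ifiltP | apply: iform_cls]. Qed.

End Filtration.

(** * The algebra structure on the special fibre and the conclusion *)

Lemma induced_filtration_exists (K : fieldType) (H : vectType K)
    (g : polyext K H -> polyext K H -> {fraction {poly K}}) :
  localized_metric g -> exists F, induced_filtration g F.
Proof.
move=> gP; have [m [E [F [a [u dP]]]]] := dual_pair_exists gP.
by exists (induced gP dP); apply: inducedP.
Qed.

(** The section [injp] need not be multiplicative, but [red] is, so the associative and unit laws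
    descend along [red]. *)
Lemma induced_mul_algebra (K : fieldType) (H : vectType K)
    (mul : polyext K H -> polyext K H -> polyext K H) :
  comm_unital_algebra mul -> comm_unital_algebra (induced_mul mul).
Proof.
move=> [mulB mulA mulC [one mul1]].
have mulE := induced_mul_red mulB.
have imulC : commutative (induced_mul mul) by move=> x y; rewrite /induced_mul mulC.
have linl b x x' y : induced_mul mul (b *: x + x') y
    = b *: induced_mul mul x y + induced_mul mul x' y.
  by rewrite /induced_mul injp_linear (mulB.1 _ b%:P) red_linear hornerC.
split=> //.
- by split=> [y b x x'|x b y y'] /=; [rewrite linl | rewrite !(imulC x) linl].
- move=> x y z; rewrite -[x]injpK -[y]injpK -[z]injpK.
  by rewrite !mulE mulA.
- by exists (red one) => x; rewrite -{1}[x]injpK mulE mul1 injpK.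
Qed.

Theorem theorem3p5 (K : fieldType) (H : vectType K)
    (mul : polyext K H -> polyext K H -> polyext K H)
    (g : polyext K H -> polyext K H -> {fraction {poly K}})
    (mul_alg : comm_unital_algebra mul)
    (g_metric : localized_metric g)
    (g_inv : forall x y z, g (mul x y) z = g x (mul y z)) :
  exists F : nondegenerate_filtration H,
    induced_filtration g F /\ mixed_frobenius_algebra (induced_mul mul) F.
Proof.
have [mulB _ mulC _] := mul_alg.
have [F [FI Fg]] := induced_filtration_exists g_metric.
exists F; split=> //; split; first exact: induced_mul_algebra.
(* By commutativity and invariance, pairing [mul A X] with [Y] is pairing [X] with [mul A Y]. *)
have mul_lattice k A X : lattice g k X -> lattice g k (mul A X).
  by move=> Xk Y; rewrite mulC g_inv.
split=> [k a x|k a x y] /FI[X Xk <-].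
  rewrite -[a]injpK (induced_mul_red mulB); apply/FI.
  by exists (mul (injp a) X) => //; apply: mul_lattice.
move=> /FI[Y Yk <-]; rewrite -[a]injpK !(induced_mul_red mulB).
rewrite !Fg //; try exact: mul_lattice.
by rewrite [mul (injp a) X]mulC g_inv.
Qed.
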